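(* Let $G$ be a nontrivial cactus on $n$ vertices with $k$ cycles, Randi\'c index $R$ and diameter $d$. Then \[R-d\geq -(k-1)\left(2-\sqrt 2\right)\qquad\text{and}\qquad R-\frac{d}{2}\geq \frac{n}{4}-(k-1)\left(\frac{7}{4}-\sqrt 2\right),\] with equality if the BC-tree of $G$ is a path and $G$ is longitudinally symmetric.
   Context: A cactus is a connected graph in which any two cycles share at most one vertex; it is nontrivial if it has no bridges (edges whose removal disconnects the graph). An articulation point is a vertex whose removal disconnects the graph; a block is a maximal connected subgraph with no articulation point of its own. The BC-tree has a vertex for each block and each articulation point, with an articulation point joined to each block containing it. A cactus whose BC-tree is a path is longitudinally symmetric if every cycle $c$ has an even number $s_c$ of vertices and any two articulation points of $G$ lying on $c$ are at distance $s_c/2$ from each other. The Randi\'c index is $R(G)=\sum_{uv\in E(G)}\frac{1}{\sqrt{d_ud_v}}$, where $d_v$ is the degree of $v$; the diameter is the maximum distance between two vertices.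
   Formalization: The graph is additionally assumed to have at least two vertices: a single vertex is connected, has no bridges and so counts as a nontrivial cactus, but there R = d = k = 0 and the first inequality would read 0 ≥ 2 − √2, which is false. *)

(* Defs.v *)
From HB Require Import structures.
From mathcomp Require Import all_boot all_order all_algebra.
From mathcomp Require Import reals.
Set Implicit Arguments. Unset Strict Implicit. Unset Printing Implicit Defensive.
Import Order.TTheory GRing.Theory Num.Theory.

Section Graphs.
Variables (T : finType) (e : rel T).

Definition simple_graph : Prop := symmetric e /\ irreflexive e.

Definition connected_graph : Prop := forall x y : T, connect e x y.

Definition deg (v : T) : nat := #|[set u | e v u]|.

Definition edge_set : {set {set T}} :=
  [set E : {set T} | [exists u, exists v, e u v && (E == [set u; v])]].

Definition randic (R : rcfType) : R :=
  \sum_(E in edge_set) (Num.sqrt (\prod_(v in E) (deg v)%:R))^-1.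

(* distance: least m such that y is reachable from x by a walk of length <= m
   (ball m x = vertices at distance <= m);  value #|T| if unreachable *)
Fixpoint ball (m : nat) (x : T) : {set T} :=
  match m with
  | 0 => [set x]
  | m'.+1 => ball m' x :|: [set y | [exists z in ball m' x, e z y]]
  end.

Definition dist (x y : T) : nat := find (fun m => y \in ball m x) (iota 0 #|T|).

Definition diameter : nat := \max_(x : T) \max_(y : T) dist x y.

Definition remove_edge (u v : T) : rel T :=
  fun a b => e a b && ~~ (((a == u) && (b == v)) || ((a == v) && (b == u))).

Definition is_bridge (u v : T) : Prop :=
  e u v /\ ~ (forall x y : T, connect (remove_edge u v) x y).

(* cycles, as subgraphs given by their (symmetric) edge set F of ordered pairs:
   a nonempty connected 2-regular subgraph *)
Definition cyc_vertices (F : {set T * T}) : {set T} :=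
  [set x | [exists y, (x, y) \in F]].

Definition is_cycle (F : {set T * T}) : bool :=
  [&& F != set0,
      [forall p in F, e p.1 p.2],
      [forall p in F, (p.2, p.1) \in F],
      [forall x in cyc_vertices F, #|[set y | (x, y) \in F]| == 2] &
      [forall x in cyc_vertices F, forall y in cyc_vertices F,
          connect (fun a b => (a, b) \in F) x y]].

Definition cycles : {set {set T * T}} := [set F | is_cycle F].

Definition num_cycles : nat := #|cycles|.

Definition cactus : Prop :=
  connected_graph /\
  forall F1 F2, is_cycle F1 -> is_cycle F2 -> F1 != F2 ->
    #|cyc_vertices F1 :&: cyc_vertices F2| <= 1.

Definition nontrivial_cactus : Prop :=
  cactus /\ forall u v, ~ is_bridge u v.

Definition remove_vertex (v : T) : rel T := fun a b => [&& e a b, a != v & b != v].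

Definition articulation (v : T) : Prop :=
  exists x y, [/\ x != v, y != v & ~~ connect (remove_vertex v) x y].

Definition induced (B : {set T}) : rel T := fun a b => [&& e a b, a \in B & b \in B].

Definition biconn_set (B : {set T}) : Prop :=
  B != set0 /\
  (forall x y, x \in B -> y \in B -> connect (induced B) x y) /\
  (forall v x y, v \in B -> x \in B :\ v -> y \in B :\ v ->
       connect (induced (B :\ v)) x y).

(* block: maximal such vertex set (maximal subgraphs with this property
   are induced, so blocks are determined by their vertex sets) *)
Definition block (B : {set T}) : Prop :=
  biconn_set B /\ forall B' : {set T}, B \subset B' -> biconn_set B' -> B' = B.

Definition bc_node (a : T + {set T}) : Prop :=
  match a with inl v => articulation v | inr B => block B end.

Definition bc_adj (a b : T + {set T}) : bool :=
  match a, b with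
  | inl v, inr B => v \in B
  | inr B, inl v => v \in B
  | _, _ => false
  end.

End Graphs.

Definition consecutive (U : eqType) (s : seq U) (u w : U) : bool :=
  has (fun p => (p == (u, w)) || (p == (w, u))) (zip s (behead s)).

Definition is_path_graph (U : eqType) (P : U -> Prop) (r : rel U) : Prop :=
  exists s : seq U, [/\ s != [::], uniq s, (forall u, P u <-> u \in s) &
     forall u w, P u -> P w -> r u w = consecutive s u w].

Definition bc_tree_is_path (T : finType) (e : rel T) : Prop :=
  is_path_graph (@bc_node T e) (@bc_adj T).

Definition long_symmetric (T : finType) (e : rel T) : Prop :=
  forall F, is_cycle e F ->
    ~~ odd #|cyc_vertices F| /\
    forall a b, articulation e a -> articulation e b ->
      a \in cyc_vertices F -> b \in cyc_vertices F -> a != b ->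
      dist e a b = #|cyc_vertices F| %/ 2.

(* Main.v *)
Require Import Defs.
From HB Require Import structures.
From mathcomp Require Import all_boot all_order all_algebra.
From mathcomp Require Import reals.
From mathcomp Require Import zify ring lra.
Import Order.TTheory GRing.Theory Num.Theory.
Set Implicit Arguments.
Unset Strict Implicit.
Unset Printing Implicit Defensive.

(** Every vertex v of a nontrivial cactus lies on t(v) >= 1 cycles and has degree
    2 t(v); gluing the cycles together one at a time gives
    sum_v t(v) = sum_C |C| = n + k - 1 =: m.  Since
    1/sqrt(ab) >= 1/sqrt a + 1/sqrt b - 1 for a, b >= 1, the Randic index is at least
    sum_v sqrt(t(v)) - m/2, and
    sqrt t >= t - (2 - sqrt 2)(t - 1) - (3/4)(t - 2)^+ for integers t >= 1.
    Both inequalities then reduce to 2 d + 3 sum_v (t(v) - 2)^+ <= m.  To prove the latter,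
    cover a geodesic by arcs of cycles: an arc of C has length at most |C|/2, consecutive
    cycles share a vertex with t >= 2, so at least sum_v (t(v) - 2)^+ cycles, each with
    three vertices or more, are not used.

    When the BC-tree is a path and the cactus is longitudinally symmetric, t <= 2, no two
    vertices with t = 2 are adjacent, and the distances |C|/2 between the ends of the cycles
    of the chain add up to m/2; all the inequalities above are then equalities. *)

(** * Cyclic sequences of vertices and the edge sets they trace *)

Definition seq_edges (T : finType) (c : seq T) : {set T * T} :=
  [set p | [&& p.1 \in c, p.2 \in c & (p.2 == next c p.1) || (p.1 == next c p.2)]].

Section SeqCycle.
Context {T : finType}.
Implicit Types (c : seq T) (x y : T).

Lemma seq_edges_sym c x y : ((x, y) \in seq_edges c) = ((y, x) \in seq_edges c).
Proof. by rewrite !inE /= orbC andbCA. Qed.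

Lemma seq_edges_next c x : x \in c -> (x, next c x) \in seq_edges c.
Proof. by move=> xc; rewrite inE /= xc mem_next xc eqxx. Qed.

Lemma cyc_vertices_seq_edges c : cyc_vertices (seq_edges c) =i c.
Proof.
move=> x; rewrite inE; apply/existsP/idP => [[y]|xc].
  by rewrite inE => /and3P[].
by exists (next c x); rewrite seq_edges_next.
Qed.

Lemma seq_edges_nbrs c x : uniq c -> x \in c ->
  [set y | (x, y) \in seq_edges c] = [set next c x; prev c x].
Proof.
move=> uc xc; apply/setP => y; rewrite !inE /= xc /=.
apply/andP/orP => [[yc /orP[/eqP->|/eqP xE]]|[/eqP->|/eqP->]].
- by left.
- by right; rewrite xE prev_next.
- by rewrite mem_next xc eqxx.
- by rewrite mem_prev xc next_prev // eqxx orbT.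
Qed.

(** Rotate [c] to start at [x]: the successor is then the second entry and the predecessor the last
    one, and these differ as soon as there are three entries. *)
Lemma next_neq_prev c x : uniq c -> 2 < size c -> x \in c -> next c x != prev c x.
Proof.
move=> uc sc xc; apply/eqP => E.
case: (rot_to xc) => i s cE.
have us : uniq (x :: s) by rewrite -cE rot_uniq.
move: sc; rewrite -(size_rot i) cE => sc.
have : next (x :: s) x = prev (x :: s) x by rewrite -cE next_rot // prev_rot.
case: s us sc {cE} => [|y [|z s]] //= us _; rewrite eqxx.
move: us; rewrite !inE !negb_or => /andP[/and3P[xy xz xs] /and3P[/andP[yz ys] _ _]].
rewrite (negbTE xy) (negbTE xz).
elim: s z {xz} xs ys yz => [|w s IH] z /=; first by rewrite eqxx => _ _ /eqP.
rewrite !inE !negb_or => /andP[xw xs] /andP[yw ys] yz.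
by rewrite (negbTE xw); apply: IH.
Qed.

Lemma connect_seq_edges c x y : uniq c -> x \in c -> y \in c ->
  connect (fun a b => (a, b) \in seq_edges c) x y.
Proof.
move=> uc xc yc; case: (rot_to xc) => i s cE.
have us : uniq (x :: s) by rewrite -cE rot_uniq.
have h : cycle (fun a b => (a, b) \in seq_edges c) (x :: s).
  have := cycle_next us; rewrite -cE => h.
  apply: (sub_in_cycle (P := mem c)) h; last first.
    by apply/allP => z; rewrite mem_rot.
  move=> a b /= ac bc /eqP <-.
  by rewrite next_rot // seq_edges_next.
move: yc; rewrite -(mem_rot i) cE => ys.
move: h => /= h; apply: (path_connect h).
by move: ys; rewrite !inE mem_rcons !inE => /orP[->|->]; rewrite ?orbT.
Qed.

End SeqCycle.

(** * Cycles as edge sets, walks and geodesics *)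

Section Cycles.
Context {T : finType} (e : rel T).
Hypothesis e_sym : symmetric e.
Hypothesis e_irr : irreflexive e.

Lemma seq_edges_sub c x y : cycle e c -> (x, y) \in seq_edges c -> e x y.
Proof.
move=> cc; rewrite inE /= => /and3P[xc yc /orP[/eqP->|/eqP->]].
  exact: next_cycle.
by rewrite e_sym next_cycle.
Qed.

Lemma is_cycle_seq_edges c : ucycle e c -> 2 < size c -> is_cycle e (seq_edges c).
Proof.
case/andP=> cc uc sc; apply/and5P; split.
- case: c sc {cc uc} => // x c _; apply/set0Pn.
  by exists (x, next (x :: c) x); rewrite seq_edges_next ?mem_head.
- by apply/forall_inP => -[x y] /= /(seq_edges_sub cc).
- by apply/forall_inP => -[x y] /=; rewrite seq_edges_sym.
- apply/forall_inP => x; rewrite cyc_vertices_seq_edges => xc.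
  by rewrite seq_edges_nbrs // cards2 next_neq_prev.
- apply/forall_inP => x; rewrite cyc_vertices_seq_edges => xc.
  apply/forall_inP => y; rewrite cyc_vertices_seq_edges => yc.
  exact: connect_seq_edges.
Qed.

Lemma is_cycle_edge F x y : is_cycle e F -> (x, y) \in F -> e x y.
Proof. by case/and5P=> _ /forall_inP h _ _ _ /h. Qed.

Lemma is_cycle_sym F x y : is_cycle e F -> (x, y) \in F -> (y, x) \in F.
Proof. by case/and5P=> _ _ /forall_inP h _ _ /h. Qed.

Lemma mem_cyc_vertices_l (F : {set T * T}) x y : (x, y) \in F -> x \in cyc_vertices F.
Proof. by move=> h; rewrite inE; apply/existsP; exists y. Qed.

Lemma mem_cyc_vertices_r F x y :
  is_cycle e F -> (x, y) \in F -> y \in cyc_vertices F.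
Proof. by move=> cF /(is_cycle_sym cF)/mem_cyc_vertices_l. Qed.

Lemma is_cycle_nbrs F x : is_cycle e F -> x \in cyc_vertices F ->
  #|[set y | (x, y) \in F]| = 2.
Proof. by case/and5P=> _ _ _ /forall_inP h _ /h/eqP. Qed.

Lemma is_cycle_connect F x y :
  is_cycle e F -> x \in cyc_vertices F -> y \in cyc_vertices F ->
  connect (fun a b => (a, b) \in F) x y.
Proof. by case/and5P=> _ _ _ _ /forall_inP h /h /forall_inP; apply. Qed.

Lemma is_cycle_vertex F : is_cycle e F -> exists x, x \in cyc_vertices F.
Proof.
by case/and5P=> /set0Pn[[x y] xy] _ _ _ _; exists x; apply: mem_cyc_vertices_l xy.
Qed.

Lemma connect_avoid x y p : path e y p -> x \notin y :: p ->
  connect (remove_vertex e x) y (last y p).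
Proof.
elim: p y => [|z p IH] y /=; first by rewrite connect0.
case/andP=> eyz pz; rewrite inE negb_or => /andP[xy xzp].
apply: connect_trans (IH _ pz xzp); apply: connect1.
rewrite /remove_vertex eyz eq_sym xy /=.
by move: xzp; rewrite inE negb_or eq_sym => /andP[].
Qed.

Lemma dist_path_le x p : path e x p -> dist e x (last x p) <= size p.
Proof.
move=> pp; have inball : last x p \in ball e (size p) x.
  elim/last_ind: p pp => [|p z IH]; first by rewrite inE.
  rewrite rcons_path last_rcons size_rcons => /andP[/IH h hz] /=.
  by rewrite !inE; apply/orP; right; apply/existsP; exists (last x p); rewrite h.
(* For a walk of length at least [#|T|] the bound is automatic, since [find] never exceeds the
   length of the list searched. *)
rewrite /dist; case: (ltnP (size p) #|T|) => sp; last first.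
  by apply: leq_trans sp; rewrite -[X in _ <= X](size_iota 0) find_size.
rewrite leqNgt; apply/negP => /(before_find 0).
by rewrite nth_iota // add0n inball.
Qed.

Lemma ball_path m x y : y \in ball e m x ->
  exists p, [/\ path e x p, last x p = y & size p <= m].
Proof.
elim: m y => [|m IH] y /=.
  by rewrite inE => /eqP->; exists [::].
rewrite inE => /orP[/IH[p [pp lp sp]]|].
  by exists p; split => //; apply: leqW.
rewrite inE => /existsP[z /andP[/IH[p [pp lp sp]] zy]].
exists (rcons p y); rewrite rcons_path last_rcons size_rcons lp zy pp.
by split.
Qed.

(** A simple path has fewer than [#|T|] edges, so the search in [dist] succeeds and does not return
    its default; the walk behind that ball membership, shortened to a simple one, is a geodesic. *)
Lemma connect_geodesic x y : connect e x y ->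
  exists p, [/\ path e x p, last x p = y, uniq (x :: p) & size p = dist e x y].
Proof.
case/connectP => p0 pp0 ->; case/shortenP: pp0 => p pp up _.
have sp : size p < #|T|.
  by have := uniq_leq_size up (fun z _ => mem_enum T z); rewrite /= -cardE.
have hd := dist_path_le pp.
have : last x p \in ball e (dist e x (last x p)) x.
  have hT : dist e x (last x p) < size (iota 0 #|T|).
    by rewrite size_iota; apply: leq_ltn_trans sp.
  have := nth_find 0 (s := iota 0 #|T|) (a := fun m => last x p \in ball e m x).
  rewrite has_find => /(_ hT); rewrite nth_iota ?add0n //.
  by move: hT; rewrite size_iota.
case/ball_path => q [pq <- sq].
case/shortenP: pq sq => q' pq' uq' subq' sq.
exists q'; split => //; apply/eqP; rewrite eqn_leq dist_path_le // andbT.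
apply: leq_trans sq.
have/andP[_ uq0] : uniq (x :: q') by [].
exact: uniq_leq_size.
Qed.

End Cycles.

(** * Degrees in a path graph *)

Lemma consecutive_index (U : eqType) (s : seq U) u w : uniq s -> consecutive s u w ->
  w \in s /\ (index w s = (index u s).+1 \/ index u s = (index w s).+1).
Proof.
move=> us; have h x y : (x, y) \in zip s (behead s) ->
    [/\ x \in s, y \in s & index y s = (index x s).+1].
  move=> /(nthP (x, x))[i isz]; rewrite nth_zip_cond isz nth_behead => -[<- <-].
  have {}isz : i.+1 < size s by move: isz; rewrite size_zip size_behead; lia.
  by rewrite !index_uniq // ?mem_nth // ltnW.
case/hasP => p ps /orP[] /eqP pE; rewrite pE in ps; case/h: ps => h1 h2 ->.
  by split => //; left.
by split => //; right.
Qed.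

(** Neighbours of [u] sit just before or just after it in the duplicate-free listing, which leaves
    room for two only. *)
Lemma path_graph_deg_le2 (U : eqType) (P : U -> Prop) (r : rel U) u w1 w2 w3 :
  is_path_graph P r -> P u -> P w1 -> P w2 -> P w3 ->
  w1 != w2 -> w2 != w3 -> w3 != w1 -> r u w1 -> r u w2 -> r u w3 -> False.
Proof.
move=> [s [_ us _ rE]] Pu P1 P2 P3 n12 n23 n31.
rewrite !rE // => /(consecutive_index us)[s1 h1] /(consecutive_index us)[s2 h2].
move=> /(consecutive_index us)[s3 h3].
have idx a b : a \in s -> b \in s -> a != b -> index a s <> index b s.
  by move=> sa sb ab E; move: ab; rewrite -(nth_index u sa) E nth_index ?eqxx.
move: (idx _ _ s1 s2 n12) (idx _ _ s2 s3 n23) (idx _ _ s3 s1 n31) h1 h2 h3.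
move: (index w1 s) (index w2 s) (index w3 s) (index u s) => a b c d; clear; lia.
Qed.

(** * Cycles and simple paths in a bridgeless cactus *)

Section Cactus.
Context {T : finType} (e : rel T).
Hypothesis e_sym : symmetric e.
Hypothesis e_irr : irreflexive e.
Hypothesis e_conn : connected_graph e.
Hypothesis cactus_share : forall F1 F2, is_cycle e F1 -> is_cycle e F2 ->
  F1 != F2 -> #|cyc_vertices F1 :&: cyc_vertices F2| <= 1.
Hypothesis bridgeless : forall u v, ~ is_bridge e u v.

Local Notation V := cyc_vertices.
Implicit Types (F : {set T * T}) (S : {set {set T * T}}).

Lemma cycle_eq F1 F2 a b : is_cycle e F1 -> is_cycle e F2 -> a != b ->
  a \in V F1 -> b \in V F1 -> a \in V F2 -> b \in V F2 -> F1 = F2.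
Proof.
move=> c1 c2 ab a1 b1 a2 b2; apply/eqP/negPn/negP => /(cactus_share c1 c2).
apply/negP; rewrite -ltnNge; apply: leq_trans (_ : #|[set a; b]| <= _).
  by rewrite cards2 ab.
by apply/subset_leq_card/subsetP => z; rewrite !inE => /orP[] /eqP->; apply/andP; split;
  move: a1 b1 a2 b2; rewrite !inE.
Qed.

Lemma edge_neq a b : e a b -> a != b.
Proof. by apply: contraTneq => ->; rewrite e_irr. Qed.

Lemma cycle_edge_eq F1 F2 a b : is_cycle e F1 -> is_cycle e F2 ->
  (a, b) \in F1 -> (a, b) \in F2 -> F1 = F2.
Proof.
move=> c1 c2 h1 h2; apply: (@cycle_eq _ _ a b) => //.
- exact/edge_neq/(is_cycle_edge c1).
- exact: mem_cyc_vertices_l h1.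
- exact: (mem_cyc_vertices_r c1 h1).
- exact: mem_cyc_vertices_l h2.
- exact: (mem_cyc_vertices_r c2 h2).
Qed.

(** As [uv] is no bridge, a simple path leads from [v] back to [u] without it; closing this path by
    [uv] gives the cycle. The path is not the single edge [vu], hence the third vertex. *)
Lemma edge_on_seq_cycle u v : e u v ->
  exists s, ucycle e [:: u, v & s] /\ 0 < size s.
Proof.
move=> euv.
have : connect (remove_edge e u v) v u.
  apply/negPn/negP => h; case: (@bridgeless u v); split => // H.
  by move: h; rewrite H.
case/connectP => p0 /shortenP[p pp up _] uE.
case/lastP: p pp up uE => [|p w] /=.
  by move=> _ _ E; move: euv; rewrite E e_irr.
rewrite last_rcons => pp up uE; subst w.
have pe : path e v (rcons p u).
  by apply: sub_path pp => a b /andP[].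
exists p; split; last first.
  by case: p pp {up pe} => //=; rewrite /remove_edge !eqxx orbT andbF.
apply/andP; split; first by rewrite /= euv.
by have : uniq (rcons (v :: p) u) := up; rewrite rcons_uniq.
Qed.

Lemma edge_on_cycle u v : e u v -> exists2 F, is_cycle e F & (u, v) \in F.
Proof.
case/edge_on_seq_cycle => s [us ss]; exists (seq_edges [:: u, v & s]).
  by apply: is_cycle_seq_edges => //.
by have := @seq_edges_next _ [:: u, v & s] u (mem_head _ _); rewrite /= eqxx.
Qed.

(** There is no need to traverse [F]: an edge of [F] at [x] lies on a cycle given by a sequence, and
    cycles of a cactus with a common edge coincide. *)
Lemma cycle_as_seq F x : is_cycle e F -> x \in V F ->
  exists s, [/\ ucycle e (x :: s), 1 < size s & F = seq_edges (x :: s)].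
Proof.
move=> cF; rewrite inE => /existsP[y xy].
have [s [us ss]] := edge_on_seq_cycle (is_cycle_edge cF xy).
exists (y :: s); split => //.
apply: (cycle_edge_eq cF (is_cycle_seq_edges e_sym us _) xy) => //.
by have := @seq_edges_next _ [:: x, y & s] x (mem_head _ _); rewrite /= eqxx.
Qed.

(* A path from [a] to [b] avoiding [v] closes up through [v] into a cycle containing both edges. *)
Lemma cycle_through F v a b : is_cycle e F -> e v b ->
  connect (remove_vertex e v) a b -> (v, a) \in F -> (v, b) \in F.
Proof.
move=> cF evb /connectP[p0 /shortenP[p pp up _] bE] vaF; subst b.
case: p pp up evb => [|z p] // pp up evb.
set c := [:: v, a, z & p].
have pv : v \notin [:: a, z & p].
  move: pp; move: (z :: p) => q {up evb c}.
  have : v != a by apply: edge_neq; apply: is_cycle_edge cF vaF.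
  elim: q a {vaF} => [|w q IH] a va /=; first by rewrite inE => _.
  case/andP => /and3P[_ _ wv] /IH; rewrite eq_sym => /(_ wv) h.
  by rewrite inE negb_or va h.
have cc : ucycle e c.
  apply/andP; split; last by rewrite cons_uniq pv up.
  rewrite (cycle_path v) /= in evb *.
  rewrite e_sym evb (is_cycle_edge cF vaF) /=.
  by move: pp; apply: sub_path => x y /and3P[].
have hc := is_cycle_seq_edges e_sym cc isT.
have va : (v, a) \in seq_edges c.
  by have := @seq_edges_next _ c v (mem_head _ _); rewrite /= eqxx.
rewrite (cycle_edge_eq cF hc vaF va).
have lc : last a (z :: p) \in c by rewrite inE mem_last orbT.
rewrite seq_edges_sym.
have := seq_edges_next lc; suff -> : next c (last a (z :: p)) = v by [].
case/andP: cc => _ uc.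
rewrite -[v in RHS](next_prev uc v); congr next.
rewrite /c /=.
move: pv; rewrite !inE !negb_or => /and3P[va' vz vp].
rewrite (negbTE va') (negbTE vz).
by elim: p z {c pp up evb hc va lc uc vz} vp => [|w s IH] z /=; rewrite ?eqxx //
  inE negb_or => /andP[/negbTE-> /IH].
Qed.

Lemma cycle_path_first F x y : is_cycle e F -> x \in V F -> y \in V F -> x != y ->
  exists2 b, (x, b) \in F & connect (remove_vertex e x) b y.
Proof.
move=> cF xF yF xy.
have /connectP[p0 /shortenP[p pp up _] yE] := is_cycle_connect cF xF yF.
case: p pp up yE => [|b p] /=; first by move=> _ _ E; rewrite E eqxx in xy.
case/andP=> xb pp /andP[xp up] ->; exists b => //; apply: connect_avoid => //.
by apply: sub_path pp => a c; apply: is_cycle_edge.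
Qed.

Lemma connect_remove_vertex_sym x : symmetric (connect (remove_vertex e x)).
Proof.
apply: sym_connect_sym => u v; rewrite /remove_vertex e_sym.
by rewrite [(u != _) && _]andbC.
Qed.

(** After its first edge [xy] the path avoids [x], and so does the cycle [F] after leaving [x]
    towards the same endpoint; [cycle_through] then puts [xy] on [F], and induction does the
    rest. *)
Lemma path_stays F x p : is_cycle e F -> path e x p -> uniq (x :: p) ->
  x \in V F -> last x p \in V F -> path (fun a b => (a, b) \in F) x p.
Proof.
move=> cF; elim: p x => // y p IH x /= /andP[exy pp] /andP[xp up] xF lF.
have xl : x != last y p by apply: contraNneq xp => ->; exact: mem_last.
have [b xb bl] := cycle_path_first cF xF lF xl.
have xyF : (x, y) \in F.
  apply: cycle_through xb => //; apply: connect_trans bl _.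
  by rewrite connect_remove_vertex_sym; apply: connect_avoid.
by rewrite xyF IH // (mem_cyc_vertices_r cF xyF).
Qed.

(** * Distances along a cycle *)

Lemma dist_triangle x y z : dist e x z <= dist e x y + dist e y z.
Proof.
have [p [pp <- _ <-]] := connect_geodesic (e_conn x y).
have [q [pq <- _ <-]] := connect_geodesic (e_conn (last x p) z).
by rewrite -last_cat -size_cat; apply: dist_path_le; rewrite cat_path pp.
Qed.

Lemma dist_sym x y : dist e x y = dist e y x.
Proof.
suff h u v : dist e u v <= dist e v u by apply/eqP; rewrite eqn_leq !h.
have [p [pp <- _ <-]] := connect_geodesic (e_conn v u).
have : path e (last v p) (rev (belast v p)).
  by rewrite rev_path; apply: sub_path pp => a b; rewrite e_sym.
move/dist_path_le; rewrite size_rev size_belast.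
by case: p {pp} => //= w p; rewrite rev_cons last_rcons.
Qed.

Lemma dist_refl x : dist e x x = 0.
Proof. by apply/eqP; rewrite -leqn0; apply: (@dist_path_le _ e x [::]). Qed.

Lemma card_cycle_seq (s : seq T) : uniq s -> #|V (seq_edges s)| = size s.
Proof. by move=> us; rewrite (eq_card (cyc_vertices_seq_edges s)); apply/card_uniqP. Qed.

Lemma card_cycle_gt2 F : is_cycle e F -> 2 < #|V F|.
Proof.
move=> cF; have [x xF] := is_cycle_vertex cF.
have [s [/andP[_ us] ss ->]] := cycle_as_seq cF xF.
by rewrite card_cycle_seq.
Qed.

(** The two arcs between [a] and [b] have total length [#|V F|], and neither is shorter than the
    distance. *)
Lemma dist_on_cycle F a b : is_cycle e F -> a \in V F -> b \in V F ->
  (dist e a b).*2 <= #|V F|.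
Proof.
move=> cF aF bF; have [s [/andP[cs us] ss FE]] := cycle_as_seq cF aF.
move: bF; rewrite FE cyc_vertices_seq_edges card_cycle_seq // inE => /orP[/eqP->|].
  by rewrite dist_refl.
move=> bs; case/splitPr: bs cs {us ss FE} => p q.
rewrite /= -cat_rcons rcons_cat cat_path last_rcons => /andP[h1 h2].
have := dist_path_le h1; have := dist_path_le h2.
by rewrite !last_rcons !size_rcons size_cat size_rcons (dist_sym b a); lia.
Qed.

Lemma antipode F a : is_cycle e F -> ~~ odd #|V F| -> a \in V F ->
  exists2 b, b \in V F & (dist e a b).*2 = #|V F|.
Proof.
move=> cF oF aF; have [s [/andP[cs us] ss FE]] := cycle_as_seq cF aF.
have mF : V F =i a :: s by move=> x; rewrite FE cyc_vertices_seq_edges.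
have cardF : #|V F| = size (a :: s) by rewrite FE card_cycle_seq.
set c := a :: s in cs us FE mF cardF.
pose h := (size c)./2.
have hE : size c = h.*2 by rewrite -[LHS]odd_double_half -{1}cardF (negbTE oF).
have hs : h < size c by rewrite /h /= in hE *; lia.
pose b := nth a c h; have bc : b \in c by rewrite mem_nth.
have bF : b \in V F by rewrite mF.
exists b => //; apply/eqP; rewrite eqn_leq dist_on_cycle //= cardF hE leq_double.
(* [f] is the cyclic distance to [a]. It changes by at most one along an edge of [F], and a geodesic
   to [b] stays on [F], so its length is at least [f b = h]. *)
pose f v := minn (index v c) (size c - index v c).
have fedge u v : (u, v) \in F -> f v <= (f u).+1.
  have hn w : w \in c -> f (next c w) <= (f w).+1 /\ f w <= (f (next c w)).+1.
    move=> wc; have := index_mem w c; rewrite wc /f => hw.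
    (* Position [i] of [s] is position [i+1] of [c]; past the end, the default [a] is the head of
       [c], which closes the cycle. *)
    have -> : next c w = nth a s (index w c) by rewrite next_nth wc.
    case: (ltnP (index w c).+1 (size c)) => hw1.
      have -> : nth a s (index w c) = nth a c (index w c).+1 by [].
      by rewrite index_uniq //; lia.
    rewrite nth_default; last by rewrite /= in hw1.
    have -> : index a c = 0 by rewrite /= eqxx.
    by move: (index w c) (size c) hw hw1 => i n; clear; lia.
  by rewrite FE inE /= => /and3P[uc vc /orP[/eqP->|/eqP->]]; case: (hn _ uc); case: (hn _ vc).
have [p [pp pl up <-]] := connect_geodesic (e_conn a b).
have lF : last a p \in V F by rewrite pl.
have {}pp := path_stays cF pp up aF lF.
have : f (last a p) <= f a + size p.
  elim: (p) (a) pp => [|y q IH] x /=; first by rewrite addn0.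
  by case/andP=> /fedge h1 /IH; lia.
by rewrite pl /f /b index_uniq // [index a c]/= eqxx; lia.
Qed.

(** * Cycles through a vertex, and degrees *)

Definition cycles_at (v : T) := [set F in cycles e | v \in V F].

Lemma in_cycles F : (F \in cycles e) = is_cycle e F.
Proof. by rewrite inE. Qed.

Lemma in_cycles_at F v : (F \in cycles_at v) = is_cycle e F && (v \in V F).
Proof. by rewrite inE in_cycles. Qed.

Lemma card_cycles_edge a b : #|[set F in cycles e | (a, b) \in F]| = e a b.
Proof.
case: (boolP (e a b)) => [/edge_on_cycle[F cF abF]|nab].
  apply/eqP/cards1P; exists F; apply/setP => F'; rewrite !inE.
  apply/andP/eqP => [[cF' abF']|->//]; exact: cycle_edge_eq cF' cF abF' abF.
apply/eqP; rewrite cards_eq0; apply/eqP/setP => F; rewrite !inE.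
by apply: contraNF nab => /andP[cF]; exact: is_cycle_edge.
Qed.

(** Count pairs of a neighbour [u] and a cycle containing [vu] in two ways: every edge lies on
    exactly one cycle, and every cycle through [v] uses two edges there. *)
Lemma deg_cycles_at v : deg e v = #|cycles_at v|.*2.
Proof.
rewrite /deg -sum1_card big_mkcond /=.
transitivity (\sum_u \sum_(F in cycles e) ((v, u) \in F : nat)).
  apply: eq_bigr => u _; rewrite inE -big_mkcondr /= sum1_card.
  transitivity (e v u : nat); first by case: (e v u).
  by rewrite -card_cycles_edge; apply: eq_card => F; rewrite inE.
rewrite exchange_big /= (bigID (fun F => v \in V F)) /= [X in _ + X]big1 ?addn0.
  rewrite -mul2n mulnC -sum_nat_const.
  rewrite [LHS](eq_bigl (fun F => F \in cycles_at v)); last first.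
    by move=> F; rewrite in_cycles_at in_cycles.
  apply: eq_bigr => F; rewrite in_cycles_at => /andP[cF vF].
  rewrite -(is_cycle_nbrs cF vF).
  rewrite -sum1_card [RHS]big_mkcond /=; apply: eq_bigr => u _; rewrite inE.
  by case: ifP.
move=> F /andP[_ nv]; apply: big1 => u _; case: (boolP (_ \in F)) => // h.
by case/negP: nv; apply: mem_cyc_vertices_l h.
Qed.

Lemma cycles_at_gt0 v : 1 < #|T| -> 0 < #|cycles_at v|.
Proof.
move=> T1; have [w wv] : exists w, w != v.
  case/card_gt1P: T1 => x [y [_ _ xy]]; case: (eqVneq x v) => [xv|]; last by exists x.
  by exists y; rewrite -xv eq_sym.
have /connectP[[|y p] /=] := e_conn v w; first by move=> _ E; rewrite E eqxx in wv.
case/andP=> /edge_on_cycle[F cF vy] _ _; apply/card_gt0P; exists F.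
by rewrite in_cycles_at cF (mem_cyc_vertices_l vy).
Qed.

(** * Gluing the cycles together one at a time *)

Definition cover_vertices S : {set T} := \bigcup_(F in S) V F.

Definition cover_rel S : rel T := fun a b => [exists F in S, (a, b) \in F].

Definition cover_connected S : Prop :=
  {in cover_vertices S &, forall a b, connect (cover_rel S) a b}.

Lemma cover_verticesP S a :
  reflect (exists2 F, F \in S & a \in V F) (a \in cover_vertices S).
Proof. exact: bigcupP. Qed.

Lemma cover_rel_edge S a b : S \subset cycles e -> cover_rel S a b -> e a b.
Proof.
move=> /subsetP sS /exists_inP[F /sS]; rewrite in_cycles; exact: is_cycle_edge.
Qed.

Lemma cover_rel_sym S : S \subset cycles e -> symmetric (cover_rel S).
Proof.
move=> /subsetP sS; suff h a b : cover_rel S a b -> cover_rel S b a.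
  by move=> a b; apply/idP/idP; apply: h.
case/exists_inP=> F FS ab; apply/exists_inP; exists F => //.
by apply: (is_cycle_sym (e := e)) ab; rewrite -in_cycles; apply: sS.
Qed.

(** If [a] and [b] differed, a simple path between them inside the union of [S] would stay on [F];
    its first edge would lie both on [F] and on a cycle of [S], forcing [F] into [S]. *)
Lemma touch_once S F a b : S \subset cycles e -> cover_connected S ->
  is_cycle e F -> F \notin S -> a \in V F -> b \in V F ->
  a \in cover_vertices S -> b \in cover_vertices S -> a = b.
Proof.
move=> sS hS cF FS aF bF aU bU; apply/eqP; apply: contraNT FS => ab.
have /connectP[p0 /shortenP[p pp up _] bE] := hS _ _ aU bU.
have pe : path e a p by apply: sub_path pp => x y; apply: cover_rel_edge.
have lF : last a p \in V F by rewrite -bE.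
have := path_stays cF pe up aF lF.
case: p pp bE {pe up lF} => [_ E|y p /= /andP[/exists_inP[F' F'S ay] _] _ /andP[ayF _]].
  by rewrite E eqxx in ab.
have cF' : is_cycle e F' by move/subsetP/(_ _ F'S): sS; rewrite in_cycles.
by rewrite (cycle_edge_eq cF cF' ayF ay).
Qed.

Lemma cover_verticesU1 S F : cover_vertices (F |: S) = V F :|: cover_vertices S.
Proof. by rewrite /cover_vertices bigcup_setU big_set1. Qed.

Lemma cover_connected1 F : is_cycle e F -> cover_connected [set F].
Proof.
move=> cF a b; rewrite /cover_vertices big_set1 => aF bF.
apply: connect_sub (is_cycle_connect cF aF bF) => x y xy; apply: connect1.
by apply/exists_inP; exists F; rewrite ?inE.
Qed.

Lemma cover_connectedU1 S F v : S \subset cycles e -> cover_connected S ->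
  is_cycle e F -> v \in V F -> v \in cover_vertices S ->
  cover_connected (F |: S).
Proof.
move=> sS hS cF vF vS.
have sFS : F |: S \subset cycles e by rewrite subUset sub1set in_cycles cF.
suff h a : a \in cover_vertices (F |: S) -> connect (cover_rel (F |: S)) a v.
  move=> a b /h av /h bv; apply: connect_trans av _.
  by rewrite (sym_connect_sym (cover_rel_sym sFS)).
rewrite cover_verticesU1 inE => /orP[aF|aS].
  apply: connect_sub (is_cycle_connect cF aF vF) => x y xy; apply: connect1.
  by apply/exists_inP; exists F; rewrite ?inE ?eqxx.
apply: connect_sub (hS _ _ aS vS) => x y /exists_inP[G GS xy]; apply: connect1.
by apply/exists_inP; exists G; rewrite ?inE ?GS ?orbT.
Qed.

(** Walk from [a] towards a cycle missing from [S]. If the walk leaves the union, the cycle of the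
    edge by which it leaves is the one sought; if the target is already covered, the missing cycle
    itself serves. *)
Lemma cover_extend S a : S \subset cycles e -> a \in cover_vertices S ->
  S != cycles e ->
  exists F v, [/\ is_cycle e F, F \notin S, v \in V F & v \in cover_vertices S].
Proof.
move=> sS aS nS; have [F1] : exists F1, F1 \in cycles e :\: S.
  apply/set0Pn; apply: contraNneq nS => /eqP; rewrite setD_eq0 => sS'.
  by rewrite eqEsubset sS.
rewrite inE in_cycles => /andP[F1S cF1]; have [b bF1] := is_cycle_vertex cF1.
case: (boolP (b \in cover_vertices S)) => [bS|nbS]; first by exists F1, b.
have /connectP[p pp bE] := e_conn a b; subst b.
elim: p a aS pp {bF1} nbS => [|y p IH] a aS /=; first by rewrite aS.
case/andP=> eay pp; case: (boolP (y \in cover_vertices S)) => yS; first exact: IH.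
move=> _; have [F cF ay] := edge_on_cycle eay.
exists F, a; split => //; last exact: mem_cyc_vertices_l ay.
apply: contraNN yS => FS; apply/cover_verticesP; exists F => //.
exact: mem_cyc_vertices_r cF ay.
Qed.

(** Induction principle for the gluing: the union stays connected, so by [touch_once] each new cycle
    is attached at exactly one vertex. The induction runs on the number of cycles left. *)
Lemma cactus_ind (P : {set {set T * T}} -> Prop) F0 : is_cycle e F0 ->
  P [set F0] ->
  (forall S F v, S \subset cycles e -> cover_connected S -> is_cycle e F ->
     F \notin S -> v \in V F -> v \in cover_vertices S ->
     V F :&: cover_vertices S = [set v] -> P S -> P (F |: S)) ->
  P (cycles e).
Proof.
move=> cF0 P0 Pstep.
suff h m S : S \subset cycles e -> cover_connected S -> F0 \in S -> P S ->
    #|cycles e :\: S| = m -> P (cycles e).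
  apply: (h _ [set F0]) => //; last exact: set11.
  - by rewrite sub1set in_cycles.
  - exact: cover_connected1.
elim: m S => [|m IH] S sS hS F0S PS.
  move/eqP; rewrite cards_eq0 setD_eq0 => sS'.
  by suff <- : S = cycles e by []; apply/eqP; rewrite eqEsubset sS.
move=> mE; have [a aF0] := is_cycle_vertex cF0.
have aS : a \in cover_vertices S by apply/cover_verticesP; exists F0.
have nS : S != cycles e by apply: contra_eq_neq mE => ->; rewrite setDv cards0.
have [F [v [cF FS vF vS]]] := cover_extend sS aS nS.
apply: (IH (F |: S)).
- by rewrite subUset sub1set in_cycles cF.
- exact: cover_connectedU1 vF vS.
- by rewrite inE F0S orbT.
- apply: (Pstep _ _ v) => //; apply/setP => w; rewrite !in_setI in_set1.
  apply/andP/eqP => [[wF wS]|->//]; exact: touch_once wF vF wS vS.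
- rewrite setUC -setDDl; have := cardsD1 F (cycles e :\: S).
  by rewrite mE in_setD FS in_cycles cF => -[].
Qed.

(** Attaching [F] at one vertex adds [#|V F|] to the sum, [#|V F| - 1] new vertices and one cycle,
    so both sides grow alike. *)
Lemma sum_card_cycles : 1 < #|T| ->
  \sum_(F in cycles e) #|V F| + 1 = #|T| + num_cycles e.
Proof.
move=> T1; have /card_gt0P[x0 _] : 0 < #|T| by apply: ltnW.
have /card_gt0P[F0] := cycles_at_gt0 x0 T1; rewrite in_cycles_at => /andP[cF0 _].
have -> : #|T| = #|cover_vertices (cycles e)|.
  rewrite -cardsT; apply: eq_card => x; rewrite inE; apply/esym/cover_verticesP.
  have /card_gt0P[F] := cycles_at_gt0 x T1.
  by rewrite in_cycles_at -in_cycles => /andP[]; exists F.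
apply: (cactus_ind (P := fun S => \sum_(F in S) #|V F| + 1 = #|cover_vertices S| + #|S|) cF0).
  by rewrite /cover_vertices !big_set1 cards1.
move=> S F v sS hS cF FS vF vS vE IH.
rewrite big_setU1 //= cover_verticesU1 cardsU1 FS cardsU vE cards1.
have : 0 < #|V F| by apply/card_gt0P; exists v.
move: IH => /=.
by move: (\sum_(G in S) #|V G|) (#|V F|) (#|cover_vertices S|) (#|S|) => a b c d; lia.
Qed.

Lemma sum_cycles_at : \sum_v #|cycles_at v| = \sum_(F in cycles e) #|V F|.
Proof.
transitivity (\sum_v \sum_(F in cycles e) (v \in V F : nat)).
  apply: eq_bigr => v _; rewrite -sum1_card big_mkcond [RHS]big_mkcond.
  by apply: eq_bigr => F _; rewrite in_cycles_at in_cycles; case: is_cycle; case: (v \in _).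
rewrite exchange_big /=; apply: eq_bigr => F _.
by rewrite -sum1_card [RHS]big_mkcond; apply: eq_bigr => v _; case: (v \in _).
Qed.

(** * Covering a path by cycles, and the bound on distances *)

Lemma split_last_mem (A : {pred T}) (x : T) p : x \in A ->
  exists p1 p2, [/\ p = p1 ++ p2, last x p1 \in A & {in p2, forall y, y \notin A}].
Proof.
move=> xA; elim/last_ind: p => [|p y [p1 [p2 [-> l1 h2]]]]; first by exists [::], [::].
case: (boolP (y \in A)) => yA.
  by exists (rcons (p1 ++ p2) y), [::]; rewrite cats0 last_rcons.
exists p1, (rcons p2 y); rewrite rcons_cat; split => // z.
by rewrite mem_rcons inE => /orP[/eqP->//|/h2].
Qed.

Lemma cycles_at_gt1 F1 F2 v : is_cycle e F1 -> is_cycle e F2 -> F1 != F2 ->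
  v \in V F1 -> v \in V F2 -> 1 < #|cycles_at v|.
Proof.
move=> c1 c2 n12 v1 v2; apply: leq_trans (_ : #|[set F1; F2]| <= _).
  by rewrite cards2 n12.
apply/subset_leq_card; apply/subsetP => F; rewrite in_set2 in_cycles_at.
by case/orP=> /eqP ->; apply/andP.
Qed.

(** Greedy cover: take the cycle [F] of the first edge, go to the last vertex [z] of the path on
    [F], and restart from [z]. Each arc costs at most half its cycle, and each restart happens at a
    vertex on two cycles. *)
Lemma path_cycles x p : path e x p -> uniq (x :: p) ->
  exists Q : {set {set T * T}}, [/\ Q \subset cycles e,
    forall F, F \in Q -> exists a b, [/\ a \in x :: p, b \in x :: p, a != b, a \in V F & b \in V F],
    (dist e x (last x p)).*2 <= \sum_(F in Q) #|V F| &
    #|Q| <= (count (fun v => 1 < #|cycles_at v|) p).+1].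
Proof.
have [n] := ubnP (size p); elim: n x p => // n IH x p sp pp up.
case: p sp pp up => [|y p] sp pp up.
  exists set0; rewrite big_set0 cards0 dist_refl sub0set; split => // F.
  by rewrite in_set0.
have /= /andP[exy pyp] := pp; have [F cF xyF] := edge_on_cycle exy.
have xF := mem_cyc_vertices_l xyF; have yF := mem_cyc_vertices_r cF xyF.
have [p1 [p2 [pE zF h2]]] := split_last_mem p yF.
set z := last y p1 in zF.
have lE : last y p = last z p2 by rewrite pE last_cat.
have dxz := dist_on_cycle cF xF zF.
have nxy : x != y by apply: edge_neq.
have zm : z \in y :: p by rewrite pE -cat_cons mem_cat mem_last.
have wit : exists a b, [/\ a \in [:: x, y & p], b \in [:: x, y & p], a != b, a \in V F & b \in V F].
  by exists x, y; split; rewrite // !in_cons eqxx ?orbT.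
move: pyp; rewrite pE cat_path => /andP[py1 pz2]; rewrite -/z in pz2.
case: (p2 =P [::]) => [p20|/eqP p2n].
  exists [set F]; rewrite sub1set in_cycles cF big_set1 cards1; split => //.
    by move=> G; rewrite in_set1 => /eqP->; rewrite -pE.
  by rewrite -pE /= lE p20 /=.
have uz : uniq (z :: p2).
  have : uniq ((y :: p1) ++ p2) by move: up; rewrite pE => /andP[].
  rewrite cat_uniq => /and3P[_ h u2]; rewrite /= u2 andbT.
  by apply: contraNN h => zp2; apply/hasP; exists z => //; exact: mem_last.
have sp2 : size p2 < n by apply: leq_trans (sp : size p < n); rewrite pE size_cat ltnS leq_addl.
have [Q [Qc Qw Qd Qn]] := IH _ _ sp2 pz2 uz.
(* This is the purpose of the two-vertex clause: cycles of [Q] meet the remaining path at least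
   twice, while [F] meets it in [z] only. *)
have FQ : F \notin Q.
  apply/negP => /Qw[a [b [az bz ab aF bF]]].
  have h w : w \in z :: p2 -> w \in V F -> w = z.
    by rewrite inE => /orP[/eqP->//|/h2/negbTE->].
  by move: ab; rewrite (h _ az aF) (h _ bz bF) eqxx.
have tz : 1 < #|cycles_at z|.
  case: (p2) p2n pz2 h2 => // w q _ /= /andP[ezw _] h2.
  have [G cG zwG] := edge_on_cycle ezw.
  apply: (cycles_at_gt1 cF cG) => //; last exact: mem_cyc_vertices_l zwG.
  by apply: contraNneq (h2 w (mem_head _ _)) => ->; apply: mem_cyc_vertices_r cG zwG.
exists (F |: Q); split.
- by rewrite subUset sub1set in_cycles cF.
- move=> G; rewrite in_setU1 => /orP[/eqP->|/Qw[a [b [az bz ab aG bG]]]].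
    by rewrite -pE.
  have sub w : w \in z :: p2 -> w \in [:: x, y & p1 ++ p2].
    rewrite -pE !inE => /orP[/eqP->|wp2]; first by move: zm; rewrite inE => ->; rewrite orbT.
    by rewrite pE mem_cat wp2 !orbT.
  by exists a, b; split => //; apply: sub.
- rewrite big_setU1 //= -pE lE; apply: leq_trans (leq_add dxz Qd).
  by rewrite -doubleD leq_double dist_triangle.
(* The restart vertex [z] lies in [y :: p1] and pays for the extra cycle. *)
- rewrite cardsU1 FQ add1n ltnS; apply: leq_trans Qn _.
  rewrite count_cat addnA -{1}[count _ p2]add0n -addSn leq_add2r.
  rewrite -[(1 < _) + _]/(count _ (y :: p1)) -has_count.
  by apply/hasP; exists z => //; apply: mem_last.
Qed.

Lemma dist_cycles_bound x y : 1 < #|T| ->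
  (dist e x y).*2 + 3 * \sum_v (#|cycles_at v| - 2) <= \sum_(F in cycles e) #|V F|.
Proof.
move=> T1; have [p [pp <- up _]] := connect_geodesic (e_conn x y).
have [Q [Qc _ Qd Qn]] := path_cycles pp up.
rewrite (big_setID Q) /= (setIidPr Qc); apply: leq_add => //.
have kE : #|cycles e :\: Q| + #|Q| = num_cycles e.
  by rewrite addnC /num_cycles -(cardsID Q (cycles e)) (setIidPr Qc).
have h3 : 3 * #|cycles e :\: Q| <= \sum_(F in cycles e :\: Q) #|V F|.
  rewrite mulnC -sum_nat_const; apply: leq_sum => F.
  by rewrite in_setD in_cycles => /andP[_ /card_cycle_gt2].
apply: leq_trans h3; rewrite leq_mul2l /=.
have cnt : count (fun v => 1 < #|cycles_at v|) p <= \sum_v (1 < #|cycles_at v|).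
  have /andP[_ up'] : uniq (x :: p) by [].
  rewrite -size_filter -(card_uniqP (filter_uniq _ up')) -sum1_card big_mkcond /=.
  by apply: leq_sum => v _; rewrite mem_filter; case: (1 < #|_|); case: (v \in p).
(* For [t >= 1], [t = (t - 2) + [t > 1] + 1] with truncated subtraction. As the [t] sum to
   [n + k - 1] and [Q] has at most [1 + #{t > 1}] cycles, at least the sum of the [t - 2] lie
   outside [Q]. *)
have tot : \sum_v (#|cycles_at v| - 2) + \sum_v (1 < #|cycles_at v|) + #|T| =
    \sum_v #|cycles_at v|.
  rewrite -sum1_card -!big_split /=; apply: eq_bigr => v _.
  by move: #|cycles_at v| (cycles_at_gt0 v T1) => m; clear; lia.
move: (sum_card_cycles T1) tot cnt Qn kE; rewrite sum_cycles_at.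
move: (\sum_v (_ - 2)) (\sum_v (1 < _)) (\sum_(F in cycles e) #|V F|) => a b c.
by move: #|_ :\: _| #|Q| (num_cycles e) #|T| (count _ _) => q1 q2 k n m; clear; lia.
Qed.

(** * Cycles as blocks, shared vertices as articulation points *)

Lemma path_induced (B : {set T}) x p : path e x p -> {subset x :: p <= B} ->
  path (induced e B) x p.
Proof.
move=> pp sB; apply: (sub_in_path (P := mem B)) pp; last by apply/allP.
by move=> a b aB bB eab; rewrite /induced eab aB.
Qed.

Lemma connect_induced_sym (B : {set T}) : symmetric (connect (induced e B)).
Proof.
by apply: sym_connect_sym => a b; rewrite /induced e_sym [(a \in B) && _]andbC.
Qed.

Lemma biconn_cycle F : is_cycle e F -> biconn_set e (V F).
Proof.
move=> cF; split; last split.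
- by have [x xF] := is_cycle_vertex cF; apply/set0Pn; exists x.
- move=> x y xF yF; apply: connect_sub (is_cycle_connect cF xF yF) => a b ab.
  apply: connect1; rewrite /induced (is_cycle_edge cF ab).
  by rewrite (mem_cyc_vertices_l ab) (mem_cyc_vertices_r cF ab).
- move=> v x y vF; have [s [/andP[cs us] ss FE]] := cycle_as_seq cF vF.
  have sE w : (w \in V F :\ v) = (w \in s).
    rewrite in_setD1 FE cyc_vertices_seq_edges inE.
    by case: eqVneq => //= ->; move: us => /= /andP[/negbTE->].
  rewrite !sE; case: s cs us {ss FE} sE => // h s /= /andP[_ cs] us sE.
  have ps : path (induced e (V F :\ v)) h s.
    apply: path_induced; first by move: cs; rewrite rcons_path => /andP[].
    by move=> w; rewrite sE.
  move=> /(path_connect ps) hx /(path_connect ps) hy.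
  by apply: connect_trans hy; rewrite connect_induced_sym.
Qed.

(** For maximality, walk inside a larger biconnected [B] from a vertex [x] of [F] to [w]. Since [B]
    minus [x] is connected, [w] reaches a neighbour of [x] on [F] off [x], so [xw] is an edge of
    [F]: the walk never leaves [F]. *)
Lemma block_cycle F : is_cycle e F -> block e (V F).
Proof.
move=> cF; split=> [|B FB [_ [Bc Bd]]]; first exact: biconn_cycle.
apply/eqP; rewrite eqEsubset FB andbT; apply/subsetP => z zB.
have [x xF] := is_cycle_vertex cF.
have xB : x \in B by apply: (subsetP FB).
have /connectP[p pp zE] := Bc _ _ xB zB.
elim: p x xF xB pp zE => [|w p IH] x xF xB /=; first by move=> _ ->.
case/andP=> /and3P[exw _ wB] pp zE; apply: IH zE => //.
have := xF; rewrite inE => /existsP[b xb]; have bF := mem_cyc_vertices_r cF xb.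
have xb' : x != b by apply: edge_neq; apply: is_cycle_edge cF xb.
have c : connect (remove_vertex e x) b w.
  apply: (connect_sub (e := induced e (B :\ x))).
    move=> a c /and3P[eac]; rewrite !in_setD1 => /andP[ax _] /andP[cx _].
    by apply: connect1; rewrite /remove_vertex eac ax.
  apply: Bd; rewrite ?in_setD1 // 1?eq_sym.
    by rewrite xb' (subsetP FB).
  by rewrite edge_neq.
exact: mem_cyc_vertices_r cF (cycle_through cF exw c xb).
Qed.

(** Neighbours of [v] on two different cycles are separated by [v]; otherwise [cycle_through] would
    give these cycles a common edge. *)
Lemma articulation_shared v : 1 < #|cycles_at v| -> articulation e v.
Proof.
case/card_gt1P=> F1 [F2 []]; rewrite !in_cycles_at => /andP[c1 v1] /andP[c2 v2] n12.
move: (v1) (v2); rewrite !inE => /existsP[a va] /existsP[b vb].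
have ea := is_cycle_edge c1 va; have eb := is_cycle_edge c2 vb.
exists a, b; split; rewrite 1?eq_sym ?edge_neq //.
apply: contraNN n12 => ab; apply/eqP; apply: (cycle_edge_eq c1 c2 _ vb).
exact: cycle_through c1 eb ab va.
Qed.

Lemma cyc_vertices_inj F1 F2 : is_cycle e F1 -> is_cycle e F2 ->
  V F1 = V F2 -> F1 = F2.
Proof.
move=> c1 c2 E; have [x x1] := is_cycle_vertex c1.
have := x1; rewrite inE => /existsP[y xy]; have y1 := mem_cyc_vertices_r c1 xy.
apply: (cycle_eq c1 c2 (edge_neq (is_cycle_edge c1 xy))) => //; by rewrite -E.
Qed.

Lemma dist_cut x y z : ~~ connect (remove_vertex e y) x z ->
  dist e x z = dist e x y + dist e y z.
Proof.
move=> ncon; apply/eqP; rewrite eqn_leq dist_triangle /=.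
have [p [pp zE up <-]] := connect_geodesic (e_conn x z).
have : y \in x :: p.
  by apply: contraNT ncon => yp; rewrite -zE; apply: connect_avoid.
rewrite inE => /orP[/eqP yx|yp].
  by rewrite yx dist_refl -zE dist_path_le.
case/splitPr: yp pp zE {up} => p1 p2.
rewrite -cat_rcons cat_path last_cat last_rcons => /andP[h1 h2] zE.
rewrite size_cat leq_add //; first by have := dist_path_le h1; rewrite last_rcons.
by rewrite -zE dist_path_le.
Qed.

(** * The equality case: chains of cycles with opposite attachments *)

Section Longitudinal.
Hypothesis T1 : 1 < #|T|.
Hypothesis bc_path : bc_tree_is_path e.
Hypothesis long_sym : long_symmetric e.

Local Notation shared v := (1 < #|cycles_at v|).

(** Three cycles at [v] would be three neighbours of [v] in the BC-tree, which is a path. *)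
Lemma cycles_at_le2 v : #|cycles_at v| <= 2.
Proof.
rewrite leqNgt; apply/negP => /card_gt2P[F1 [F2 [F3 []]]].
rewrite !in_cycles_at => -[/andP[c1 v1] /andP[c2 v2] /andP[c3 v3]] [n12 n23 n31].
have av : articulation e v by apply: articulation_shared; apply: cycles_at_gt1 n12 v1 v2.
have inj F G : is_cycle e F -> is_cycle e G -> F != G -> inr (V F) != inr (V G) :> T + {set T}.
  by move=> cF cG; apply: contraNneq => -[/(cyc_vertices_inj cF cG)->].
apply: (path_graph_deg_le2 bc_path (u := inl v) _ _ _ _ (inj _ _ c1 c2 n12)
  (inj _ _ c2 c3 n23) (inj _ _ c3 c1 n31)) => //=; exact: block_cycle.
Qed.

Lemma shared_le2 F a b c : is_cycle e F -> a \in V F -> b \in V F -> c \in V F ->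
  shared a -> shared b -> shared c -> a != b -> b != c -> c != a -> False.
Proof.
move=> cF aF bF cF' sa sb sc ab bc ca.
have inj u v : u != v -> inl u != inl v :> T + {set T} by apply: contraNneq => -[->].
apply: (path_graph_deg_le2 bc_path (u := inr (V F)) _ _ _ _ (inj _ _ ab)
  (inj _ _ bc) (inj _ _ ca)) => //=; by [exact: block_cycle | exact: articulation_shared].
Qed.

Lemma shared_opposite F a b : is_cycle e F -> a \in V F -> b \in V F ->
  shared a -> shared b -> a != b -> (dist e a b).*2 = #|V F|.
Proof.
move=> cF aF bF /articulation_shared sa /articulation_shared sb ab.
have [ev ->] := long_sym cF => //; by rewrite divn2 even_halfK.
Qed.

(** Shared vertices of a cycle are opposite; at distance one they would leave the cycle only two
    vertices. *)
Lemma shared_nonadjacent a b : e a b -> shared a -> shared b -> False.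
Proof.
move=> eab sa sb; have [F cF abF] := edge_on_cycle eab.
have aF := mem_cyc_vertices_l abF; have bF := mem_cyc_vertices_r cF abF.
have dE := shared_opposite cF aF bF sa sb (edge_neq eab).
have d1 : dist e a b <= 1 by apply: (@dist_path_le _ e a [:: b]); rewrite /= eab.
by have := card_cycle_gt2 cF; rewrite -dE; move: d1; case: (dist e a b) => [|[|]].
Qed.

(** A second shared vertex, if there is one, is opposite to [a] by symmetry and no third exists;
    otherwise the even length of [F] provides an antipode. *)
Lemma far_vertex F a : is_cycle e F -> a \in V F ->
  (forall v, v \in V F -> shared v -> shared a) ->
  exists z, [/\ z \in V F, (dist e a z).*2 = #|V F| &
    forall v, v \in V F -> shared v -> v = a \/ v = z].
Proof.
move=> cF aF ha; case: (pickP [pred z | [&& z \in V F, shared z & z != a]]) => [z|none].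
  case/and3P=> zF sz za; have sa := ha z zF sz.
  exists z; split => //; first by rewrite (shared_opposite cF) // eq_sym.
  move=> v vF sv; case: (eqVneq v a) => [|va]; [by left | right].
  apply/eqP/negPn/negP => vz; apply: (shared_le2 cF vF zF aF) => //.
  by rewrite eq_sym.
have [z zF dz] := antipode cF (long_sym cF).1 aF.
exists z; split => // v vF sv; left; apply/eqP.
by have /= := none v; rewrite vF sv => /negbFE.
Qed.

Lemma cycles_diametral_pair : exists x y,
  (dist e x y).*2 = \sum_(F in cycles e) #|V F|.
Proof.
have /card_gt0P[x0 _] : 0 < #|T| by apply: ltnW.
have /card_gt0P[F0] := cycles_at_gt0 x0 T1; rewrite in_cycles_at => /andP[cF0 x0F].
(* Invariant of the gluing: the ends [x] and [y] of the chain are as far apart as the cycles allow,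
   and further cycles can be attached only at these ends. *)
pose P S := exists x y, [/\ x \in cover_vertices S, y \in cover_vertices S,
  (dist e x y).*2 = \sum_(F in S) #|V F| &
  forall w G, w \in cover_vertices S -> is_cycle e G -> G \notin S -> w \in V G ->
    w = x \/ w = y].
suff [x [y [_ _ d _]]] : P (cycles e) by exists x, y.
apply: (cactus_ind cF0) => [|S F v sS hS cF FS vF vS _].
  have [a [aF ha]] : exists a, a \in V F0 /\
      forall v, v \in V F0 -> shared v -> shared a.
    case: (pickP [pred z in V F0 | shared z]) => [a /andP[]|none]; first by exists a.
    by exists x0; split => // v vF sv; have /= := none v; rewrite vF sv.
  have [z [zF dz hz]] := far_vertex cF0 aF ha.
  exists a, z; rewrite /cover_vertices !big_set1; split => // w G wF cG.
  rewrite in_set1 => GF wG; apply: hz => //; exact: cycles_at_gt1 GF wG wF.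
case=> x [y [xS yS dxy open_S]].
wlog vy : x y xS yS dxy open_S / v = y.
  move=> W; case: (open_S v F vS cF FS vF) => [vx|vy]; last exact: (W x y).
  apply: (W y x) => //; first by rewrite dist_sym.
  by move=> w G h1 h2 h3 h4; case: (open_S w G h1 h2 h3 h4); [right | left].
subst v; have /cover_verticesP[F' F'S yF'] := yS.
have cF' : is_cycle e F' by rewrite -in_cycles (subsetP sS).
have nFF' : F != F' by apply: contraNneq FS => ->.
have sy : shared y by apply: cycles_at_gt1 nFF' vF yF'.
have [z [zF dyz hz]] := far_vertex cF vF (fun _ _ _ => sy).
have yx : y != x.
  apply: contraTneq F'S => E; move: dxy; rewrite E dist_refl => /esym/eqP.
  rewrite sum_nat_eq0 => /forall_inP h; apply/negP => /h; rewrite cards_eq0.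
  by apply/negP/set0Pn; exists y.
have yz : y != z.
  by apply: contraTneq (card_cycle_gt2 cF) => E; rewrite -dyz E dist_refl.
(* Were [x] joined to [z] off [y], the first edge [ya] of a path from [y] to [x] within [S] would
   lie on [F], yet it already lies on a cycle of [S]. Hence distances add at [y]. *)
have cut : ~~ connect (remove_vertex e y) x z.
  apply/negP => xz.
  have /connectP[p0 /shortenP[p pp up _] xE] := hS _ _ yS xS.
  case: p pp up xE => [|a p] /=; first by move=> _ _ E; rewrite E eqxx in yx.
  case/andP=> /exists_inP[G GS yaG] pp /andP[yp up] xE.
  have cG : is_cycle e G by rewrite -in_cycles (subsetP sS).
  have [b yb bz] := cycle_path_first cF vF zF yz.
  have ax : connect (remove_vertex e y) a x.
    by rewrite xE; apply: connect_avoid yp; apply: sub_path pp => u w; apply: cover_rel_edge.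
  have yaF : (y, a) \in F.
    apply: cycle_through yb => //; first exact: is_cycle_edge cG yaG.
    apply: connect_trans bz _; rewrite connect_remove_vertex_sym.
    exact: connect_trans ax xz.
  by case/negP: FS; rewrite (cycle_edge_eq cF cG yaF yaG).
exists x, z; rewrite !cover_verticesU1; split.
- by rewrite in_setU xS orbT.
- by rewrite in_setU zF.
- by rewrite big_setU1 //= -dxy -dyz (dist_cut cut) doubleD addnC.
move=> w G; rewrite in_setU in_setU1 negb_or => wU cG /andP[GF GS] wG.
(* The old end [y] is closed: it now lies on [F] and [F'], and a third cycle is excluded. *)
have wy : w != y.
  apply: contraTneq (cycles_at_le2 y) => E; rewrite E in wG; rewrite -ltnNge.
  apply/card_gt2P; exists F, F', G; rewrite !in_cycles_at cF cF' cG vF yF' wG nFF' GF.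
  by split => //; split => //; apply: contraNneq GS => <-.
case/orP: wU => [wF|wS].
  have sw : shared w by apply: cycles_at_gt1 GF wG wF.
  by case: (hz w wF sw) => E; [rewrite E eqxx in wy | right].
by case: (open_S w G wS cG GS wG) => E; [left | rewrite E eqxx in wy].
Qed.

End Longitudinal.

End Cactus.

Local Open Scope ring_scope.

(** * The Randic index in terms of the numbers of cycles at the vertices *)

Section Randic.
Context {T : finType} (e : rel T).
Hypothesis e_sym : symmetric e.
Hypothesis e_irr : irreflexive e.

(** Sums over unordered edges become sums over ordered pairs: the fibre over the edge of [u] and [v]
    consists of [(u, v)] and [(v, u)]. *)
Lemma sum_edge_set (M : nmodType) (f : {set T} -> M) :
  (\sum_(E in edge_set e) f E) *+ 2 = \sum_u \sum_(v | e u v) f [set u; v].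
Proof.
rewrite pair_big_dep /=.
rewrite (partition_big (fun p : T * T => [set p.1; p.2]) (mem (edge_set e))) /=; last first.
  case=> u v /= euv; rewrite inE; apply/existsP; exists u; apply/existsP; exists v.
  by rewrite euv eqxx.
rewrite -sumrMnl; apply: eq_bigr => E; rewrite inE.
case/existsP=> u /existsP[v /andP[euv /eqP->]].
have uv : u != v by exact: edge_neq euv.
rewrite (eq_bigl (fun p => p \in [set (u, v); (v, u)])); last first.
  case=> a b /=; rewrite !inE !xpair_eqE.
  apply/andP/orP => [[eab /eqP abE]|[]/andP[/eqP-> /eqP->]]; last 2 first.
  - by rewrite euv eqxx.
  - by rewrite e_sym euv setUC eqxx.
  have ab : a != b by exact: edge_neq eab.
  have : a \in [set u; v] by rewrite -abE set21.
  have : b \in [set u; v] by rewrite -abE set22.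
  rewrite !inE => /orP[]/eqP bE /orP[]/eqP aE; rewrite aE bE ?eqxx in ab *.
  - by [].
  - by right.
  - by left.
  - by [].
rewrite big_setU1 ?big_set1 /=; first by rewrite mulr2n [[set v; u]]setUC.
by rewrite inE xpair_eqE (negbTE uv).
Qed.

Variables (R : realType) (t : T -> nat).
Hypothesis degE : forall v, deg e v = (t v).*2.
Hypothesis t_gt0 : forall v, (0 < t v)%N.

Local Notation s v := (Num.sqrt (t v)%:R : R).

Lemma sqrt_natr_ge1 n : (0 < n)%N -> 1 <= Num.sqrt n%:R :> R.
Proof. by move=> n0; rewrite -[leLHS]sqrtr1; apply: ler_wsqrtr; rewrite ler1n. Qed.

Lemma randic_darts : randic e R *+ 2 = \sum_u \sum_(v | e u v) (2 * s u * s v)^-1.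
Proof.
rewrite /randic sum_edge_set; apply: eq_bigr => u _; apply: eq_bigr => v euv.
rewrite big_setU1 ?inE ?(edge_neq e_irr) //= big_set1 !degE -!mul2n !natrM.
rewrite !sqrtrM ?mulr_ge0 ?ler0n //.
have -> : Num.sqrt 2%:R * s u * (Num.sqrt 2%:R * s v) = Num.sqrt 2%:R ^+ 2 * s u * s v :> R by ring.
by rewrite sqr_sqrtr ?ler0n.
Qed.

(** The vertex [u] contributes [2 t(u)] times [1/sqrt(t(u))], that is [2 sqrt(t(u))]. *)
Lemma sum_darts_l : \sum_u \sum_(v | e u v) (s u)^-1 = (\sum_v s v) *+ 2.
Proof.
rewrite -sumrMnl; apply: eq_bigr => u _; rewrite sumr_const.
have -> : #|e u| = deg e u by apply: eq_card => v; rewrite inE.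
have s0 : s u != 0 by rewrite gt_eqF // sqrtr_gt0 ltr0n.
have sE : s u ^+ 2 = (t u)%:R by rewrite sqr_sqrtr ?ler0n.
rewrite degE -mul2n -[LHS]mulr_natr natrM; move: (s u) s0 sE => a a0 <-.
by rewrite -[RHS]mulr_natr; field.
Qed.

Lemma sum_darts_r : \sum_u \sum_(v | e u v) (s v)^-1 = (\sum_v s v) *+ 2.
Proof.
rewrite (exchange_big_dep predT) //= -sum_darts_l.
by apply: eq_bigr => u _; apply: eq_bigl => v; rewrite e_sym.
Qed.

Lemma sum_darts_1 : \sum_u \sum_(v | e u v) (1 : R) = (\sum_v t v)%:R *+ 2.
Proof.
rewrite natr_sum -sumrMnl; apply: eq_bigr => u _; rewrite sumr_const.
have -> : #|e u| = deg e u by apply: eq_card => v; rewrite inE.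
by rewrite degE -addnn natrD mulr2n.
Qed.

Lemma sum_darts_linear :
  \sum_u \sum_(v | e u v) (((s u)^-1 + (s v)^-1 - 1) / 2)
    = (\sum_v s v - (\sum_v t v)%:R / 2) *+ 2.
Proof.
transitivity (\sum_u (\sum_(v | e u v) (s u)^-1 + \sum_(v | e u v) (s v)^-1
    - \sum_(v | e u v) 1) / 2).
  by apply: eq_bigr => u _; rewrite -big_split -sumrB mulr_suml.
rewrite -mulr_suml sumrB big_split /= sum_darts_l sum_darts_r sum_darts_1.
by field.
Qed.

(* [(1 - 1/a) (1 - 1/b) >= 0] *)
Lemma randic_ge : \sum_v s v - (\sum_v t v)%:R / 2 <= randic e R.
Proof.
suff : (\sum_v s v - (\sum_v t v)%:R / 2) *+ 2 <= randic e R *+ 2.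
  by rewrite lerMn2r.
rewrite -sum_darts_linear randic_darts.
apply: ler_sum => u _; apply: ler_sum => v _.
have := sqrt_natr_ge1 (t_gt0 u); have := sqrt_natr_ge1 (t_gt0 v).
move: (s u) (s v) => a b b1 a1.
have a0 : 0 < a by apply: lt_le_trans a1.
have b0 : 0 < b by apply: lt_le_trans b1.
have a' : a^-1 <= 1 by rewrite invf_le1.
have b' : b^-1 <= 1 by rewrite invf_le1.
rewrite !invfM; nra.
Qed.

(** The product [(1 - 1/a) (1 - 1/b)] vanishes on every edge having an end with [t = 1]. *)
Lemma randic_eq : (forall u v, e u v -> t u = 1%N \/ t v = 1%N) ->
  randic e R = \sum_v s v - (\sum_v t v)%:R / 2.
Proof.
move=> h; have : randic e R *+ 2 = (\sum_v s v - (\sum_v t v)%:R / 2) *+ 2.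
  rewrite -sum_darts_linear randic_darts.
  apply: eq_bigr => u _; apply: eq_bigr => v /h.
  have u0 : s u != 0 by rewrite gt_eqF // sqrtr_gt0 ltr0n.
  have v0 : s v != 0 by rewrite gt_eqF // sqrtr_gt0 ltr0n.
  by case=> tE; move: u0 v0; rewrite tE sqrtr1 => u0 v0; field.
by apply: pmulrnI.
Qed.

(** Equality holds at 1 and 2. Writing [n + 3] for larger arguments, the left side is
    [n (sqrt 2 - 7/4) + 2 sqrt 2 - 7/4], at most [5/4] because [sqrt 2 <= 3/2], and [5/4] is below
    [sqrt 3]. *)
Lemma sqrt_nat_ge n : (0 < n)%N ->
  n%:R - (2 - Num.sqrt 2) * (n - 1)%:R - 3 / 4 * (n - 2)%:R <= Num.sqrt n%:R :> R.
Proof.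
move: n => [|[|[|n]]] // _.
- by rewrite sqrtr1 (_ : 1 - 1 = 0)%N // (_ : 1 - 2 = 0)%N //; lra.
- by rewrite (_ : 2 - 1 = 1)%N // (_ : 2 - 2 = 0)%N //; lra.
rewrite (_ : n.+3 - 1 = n.+2)%N ?subn1 // (_ : n.+3 - 2 = n.+1)%N ?subn2 //.
have q32 : Num.sqrt 2 <= 3 / 2 :> R.
  rewrite -[leRHS]ger0_norm; last by lra.
  by rewrite -sqrtr_sqr ler_wsqrtr //; lra.
have r54 : 5 / 4 <= Num.sqrt n.+3%:R :> R.
  rewrite -[leLHS]ger0_norm; last by lra.
  rewrite -sqrtr_sqr ler_wsqrtr // -[n.+3]addn3 natrD.
  by have := ler0n R n; lra.
apply: le_trans r54; rewrite -[n.+3]addn3 -[n.+2]addn2 -[n.+1]addn1 !natrD.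
by have := ler0n R n; nra.
Qed.

End Randic.

(** * Assembling the two inequalities and the equality case *)

Theorem theorem5p2 (R : realType) (T : finType) (e : rel T) :
  simple_graph e -> (1 < #|T|)%N -> nontrivial_cactus e ->
  let n := #|T| in let k := num_cycles e in
  let RR := randic e R in let d := diameter e in
  (RR - d%:R >= - (k%:R - 1) * (2 - Num.sqrt 2) /\
   RR - d%:R / 2 >= n%:R / 4 - (k%:R - 1) * (7 / 4 - Num.sqrt 2)) /\
  (bc_tree_is_path e -> long_symmetric e ->
   RR - d%:R = - (k%:R - 1) * (2 - Num.sqrt 2) /\
   RR - d%:R / 2 = n%:R / 4 - (k%:R - 1) * (7 / 4 - Num.sqrt 2)).
Proof.
move=> [e_sym e_irr] T1 [[e_conn share] nobridge] n k RR d.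
pose t v := #|cycles_at e v|; pose q : R := Num.sqrt 2.
have degE v : deg e v = (t v).*2 by exact: (deg_cycles_at e_sym e_irr share nobridge).
have t0 v : (0 < t v)%N by exact: (cycles_at_gt0 e_sym e_irr e_conn nobridge).
pose m := (\sum_v t v)%N; pose S := (\sum_v (t v - 2))%N.
have mE : m = (\sum_(F in cycles e) #|cyc_vertices F|)%N by exact: sum_cycles_at.
have mnk : (m + 1 = n + k)%N.
  by rewrite mE; apply: (sum_card_cycles e_sym e_irr e_conn share nobridge).
have {}mnk : m%:R + 1 = n%:R + k%:R :> R.
  by have := congr1 (fun i => i%:R : R) mnk; rewrite /= !natrD.
have dS : (d.*2 + 3 * S <= m)%N.
  have [x [y ->]] : exists x y, d = dist e x y.
    have [x xE] := @bigop.eq_bigmax _ (fun x => \max_y dist e x y)%N (ltnW T1).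
    have [y yE] := @bigop.eq_bigmax _ (fun y => dist e x y) (ltnW T1).
    by exists x, y; rewrite -yE -xE.
  by rewrite mE; apply: (dist_cycles_bound e_sym e_irr e_conn share nobridge).
have {}dS : 2 * d%:R + 3 * S%:R <= m%:R :> R.
  by rewrite -!natrM -natrD ler_nat mul2n.
have sum_t1 : \sum_v (t v - 1)%:R = k%:R - 1 :> R.
  under eq_bigr => v _ do rewrite natrB //.
  rewrite sumrB -natr_sum sumr_const -/m (_ : #|_| = n) //.
  by rewrite -mulr_natr mul1r; move: mnk; lra.
have sumE : \sum_v ((t v)%:R - (2 - q) * (t v - 1)%:R - 3 / 4 * (t v - 2)%:R)
    = m%:R - (2 - q) * (k%:R - 1) - 3 / 4 * S%:R :> R.
  by rewrite !sumrB -!mulr_sumr sum_t1 -!natr_sum.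
have lower : m%:R - (2 - q) * (k%:R - 1) - 3 / 4 * S%:R - m%:R / 2 <= RR.
  apply: le_trans (randic_ge e_sym e_irr R degE t0); rewrite lerD2r -sumE.
  by apply: ler_sum => v _; apply: sqrt_nat_ge.
(* Since [d <= m/2 - 3 S/2], subtracting [d] leaves a surplus [3 S/4], while subtracting [d/2]
   cancels [S] exactly; [m = n + k - 1] turns [m/4] into [n/4 + (k - 1)/4]. *)
split; first by split; move: mnk dS lower (ler0n R S); rewrite -/q; lra.
move=> bc_path long_sym.
have t2 v : (t v <= 2)%N by exact: (cycles_at_le2 e_sym e_irr share nobridge bc_path).
(* With [t] equal to 1 or 2 everywhere and no two adjacent vertices having [t = 2], both estimates
   behind [lower] are equalities. *)
have RRE : RR = m%:R - (2 - q) * (k%:R - 1) - m%:R / 2.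
  rewrite /RR (randic_eq e_sym e_irr R degE t0) => [|u v euv]; last first.
    have := shared_nonadjacent e_sym e_irr share nobridge long_sym euv.
    by rewrite -/(t u) -/(t v); move: (t u) (t v) (t0 u) (t0 v) => a b; clear; lia.
  congr (_ - _); transitivity (\sum_v ((t v)%:R - (2 - q) * (t v - 1)%:R) : R).
    apply: eq_bigr => v _.
    by case: (t v) (t0 v) (t2 v) => [|[|[|]]] // _ _; rewrite subn1 /= /q ?sqrtr1; lra.
  by rewrite sumrB -mulr_sumr sum_t1 -natr_sum.
have dm : 2 * d%:R = m%:R :> R.
  apply/eqP; rewrite eq_le; apply/andP; split.
    by apply: le_trans dS; rewrite lerDl mulr_ge0.
  have [x [y xyE]] := cycles_diametral_pair e_sym e_irr e_conn share nobridge T1 bc_path long_sym.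
  rewrite mE -xyE -mul2n natrM ler_wpM2l // ler_nat.
  apply: leq_trans (leq_bigmax x); exact: (leq_bigmax y).
by split; move: mnk dm RRE; rewrite -/q; lra.
Qed.
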